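(* Let $n \geq 1$ and let $G = \bigcup_{i=1}^{n} A_i$ be a graph which is the union of $n$ complete graphs $A_1, A_2, \dots, A_n$, each having exactly $n$ vertices, such that every pair of distinct complete graphs $A_i, A_j$ has at most one common vertex. Suppose that every $A_i$ ($1 \leq i \leq n$) contains at most $\sqrt{n}$ vertices of clique degree greater than $1$. Then $G$ is $n$-colorable, i.e. there is a proper vertex coloring of $G$ using $n$ colors.
   Context: For a vertex $v$ of $G$, the clique degree is $d^K(v) = |\{A_i : v \in V(A_i),\ 1 \leq i \leq n\}|$, the number of the complete graphs $A_i$ containing $v$. *)

(* Defs.v *)
From mathcomp Require Import all_boot all_order all_algebra.

Set Implicit Arguments.
Unset Strict Implicit.
Unset Printing Implicit Defensive.

(* Finite simple graphs. A union of n complete graphs on n vertices each has at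
   most n ^ 2 vertices, so finiteness of the vertex type is no restriction. *)
Record sgraph := SGraph {
  vertex :> finType;
  adj : rel vertex;
  adj_sym : symmetric adj;
  adj_irr : irreflexive adj
}.

(* A complete graph is determined by its vertex set, so a family of complete
   graphs in G is given by the family A of their vertex sets. The two conjuncts
   say that V(G) is the union of the V(A_i), and E(G) the union of the E(A_i). *)
Definition union_of_complete (G : sgraph) (n : nat) (A : 'I_n -> {set G}) : Prop :=
  (forall v : G, exists i : 'I_n, v \in A i) /\
  (forall u v : G,
     adj u v <-> exists i : 'I_n, [/\ u \in A i, v \in A i & u != v]).

(* Counts complete graphs rather than indices: this is the cardinality of the
   set {A_i : v \in V(A_i)}. *)
Definition clique_degree (G : sgraph) (n : nat) (A : 'I_n -> {set G}) (v : G) : nat :=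
  #|[set A i | i : 'I_n & v \in A i]|.

Definition proper_coloring (G : sgraph) (k : nat) (c : G -> 'I_k) : Prop :=
  forall u v : G, adj u v -> c u != c v.

Definition colorable (G : sgraph) (k : nat) : Prop :=
  exists c : G -> 'I_k, proper_coloring c.

(* Main.v *)
(** Colour greedily in order of decreasing clique degree. Let m be the largest
    number of vertices of clique degree > 1 in some A_i, so m ^ 2 <= n, and let v
    have clique degree d; only neighbours of clique degree >= d are coloured
    before v. If d = 1 there are at most n - 1 neighbours in all. If
    1 < d <= m there are at most d (m - 1) < n earlier ones. If d > m, counting
    incidences gives d |U| <= n m for the set U of vertices of clique degree
    >= d, hence |U| < n. *)
Require Import Defs.
From mathcomp Require Import all_boot all_order all_algebra.

Set Implicit Arguments.
Unset Strict Implicit.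
Unset Printing Implicit Defensive.

Import Order.TTheory GRing.Theory Num.Theory.

Lemma exists_unused (T : finType) (k : nat) (N : {set T}) (c : T -> 'I_k) :
  #|N| < k -> exists a, a \notin c @: N.
Proof.
move=> ltNk; apply/existsP; rewrite -negb_forall; apply/negP => /forallP allc.
have: #|c @: N| < k by apply: leq_ltn_trans (leq_imset_card _ _) ltNk.
suff -> : c @: N = setT by rewrite cardsT card_ord ltnn.
by apply/setP => a; rewrite inE allc.
Qed.

Lemma card_bigcup_le (I T : finType) (P : pred I) (F : I -> {set T}) :
  #|\bigcup_(i | P i) F i| <= \sum_(i | P i) #|F i|.
Proof.
elim/big_rec2: _ => [|i m B _ leBm]; first by rewrite cards0.
by apply: leq_trans (leq_card_setU _ _) _; rewrite leq_add2l.
Qed.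

(** Greedy colouring in order of decreasing [f], run as an induction on the size of the vertex set
    [S] still to be coloured. *)
Lemma greedy_colorable (G : sgraph) (k : nat) (f : G -> nat) :
  0 < k -> (forall v, #|[set u | adj u v & f v <= f u]| < k) -> colorable G k.
Proof.
move=> k_gt0 ltk.
suff colS m (S : {set G}) : #|S| = m ->
    exists c : G -> 'I_k, {in S &, forall u v, adj u v -> c u != c v}.
  have [c cP] := colS _ [set: G] erefl.
  by exists c => u v; apply: cP; rewrite inE.
elim: m S => [|m IHm] S cardS.
  exists (fun=> Ordinal k_gt0) => u v.
  by rewrite (cards0_eq cardS) inE.
have [x xS] : exists x, x \in S by apply/set0Pn; rewrite -card_gt0 cardS.
(* A vertex minimizing [f] on [S] is coloured last: by minimality all its neighbours in [S] lie in
   the set bounded by [ltk], so some colour is free. *)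
case: (arg_minnP f xS) => v; rewrite -/(v \in S) => vS vmin.
have [c cP] : exists c : G -> 'I_k,
    {in S :\ v &, forall u w, adj u w -> c u != c w}.
  by apply: IHm; move: cardS; rewrite (cardsD1 v) vS => -[].
have [a aP] := exists_unused c (ltk v).
have aE u : u \in S -> adj u v -> c u != a.
  move=> uS uv; apply: contraNneq aP => <-.
  by apply: imset_f; rewrite inE uv vmin.
exists (fun u => if u == v then a else c u) => u w uS wS.
case: (eqVneq u v) => [->|uv]; case: (eqVneq w v) => [->|wv].
- by rewrite adj_irr.
- by rewrite adj_sym eq_sym; apply: aE.
- exact: aE.
- by apply: cP; rewrite !inE ?uv ?wv.
Qed.

Section UnionOfComplete.
Variables (G : sgraph) (n : nat) (A : 'I_n -> {set G}).
Hypothesis G_union : union_of_complete A.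

(** Each neighbour shares a clique with [v]. Since [v] satisfies [P] itself, it takes one of the at
    most [k] places in each of its cliques, whence [k.-1]. *)
Lemma card_neighbours_le (P : pred G) (k : nat) (v : G) :
  P v -> (forall i, #|[set u in A i | P u]| <= k) ->
  #|[set u | adj u v & P u]| <= clique_degree A v * k.-1.
Proof.
move=> Pv leAk; set D := [set A i | i : 'I_n & v \in A i].
have sub : [set u | adj u v & P u] \subset
    \bigcup_(B in D) ([set u in B | P u] :\ v).
  apply/subsetP => u; rewrite inE => /andP[/(G_union.2 u v)[i [ui vi uv]] Pu].
  apply/bigcupP; exists (A i); last by rewrite !inE uv ui.
  by apply/imsetP; exists i; rewrite ?inE.
apply: leq_trans (subset_leq_card sub) _.
rewrite -sum_nat_const; apply: leq_trans (card_bigcup_le _ _) _.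
apply: leq_sum => _ /imsetP[i vi ->]; rewrite inE in vi.
have := leAk i; rewrite (cardsD1 v) !inE vi Pv /=.
by case: k {leAk} => [|k].
Qed.

(** Double counting of the pairs of a vertex of [U] and a clique containing it. *)
Lemma sum_clique_degree (U : {set G}) (m : nat) :
  (forall i, #|U :&: A i| <= m) ->
  \sum_(u in U) clique_degree A u <= n * m.
Proof.
move=> leUm; set F := [set A i | i : 'I_n].
have degE u : clique_degree A u = \sum_(B in F) (u \in B).
  rewrite /clique_degree -sum1_card big_mkcond [RHS]big_mkcond /=.
  apply: eq_bigr => B _; case: (boolP (B \in F)) => [/imsetP[i _ ->]|BF].
    case: (boolP (u \in A i)) => ui; case: imsetP => //.
      by case; exists i; rewrite ?inE.
    by case=> j; rewrite inE => uj Aij; rewrite Aij uj in ui.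
  by case: imsetP => // -[j _ Bj]; rewrite Bj imset_f in BF.
rewrite (eq_bigr _ (fun u _ => degE u)) exchange_big /=.
(* [F] collects distinct cliques, so it has at most [n] members, fewer if [A] repeats one. *)
apply: (@leq_trans (#|F| * m)); last first.
  rewrite leq_mul2r; apply/orP; right.
  by apply: leq_trans (leq_imset_card _ _) _; rewrite card_ord.
rewrite -sum_nat_const; apply: leq_sum => _ /imsetP[i _ ->].
apply: leq_trans (leUm i); rewrite -sum1_card -big_mkcondr /=.
by apply: eq_leq; apply: eq_bigl => u; rewrite inE.
Qed.

Lemma card_earlier_neighbours (m : nat) (v : G) :
  0 < n -> m * m <= n -> (forall i, #|A i| = n) ->
  (forall i, #|[set u in A i | 1 < clique_degree A u]| <= m) ->
  #|[set u | adj u v & clique_degree A v <= clique_degree A u]| < n.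
Proof.
move=> n_gt0 mm A_card leWm; set d := clique_degree A v.
have d_gt0 : 0 < d.
  have [i vi] := G_union.1 v.
  by apply/card_gt0P; exists (A i); apply/imsetP; exists i; rewrite ?inE.
have ltn_pred : n.-1 < n by rewrite prednK.
have [d_le1|d_gt1] := leqP d 1.
  apply: leq_ltn_trans (card_neighbours_le (k := n) (leqnn d) _) _.
    move=> i; rewrite -[X in _ <= X](A_card i); apply: subset_leq_card.
    by apply/subsetP => u; rewrite inE => /andP[].
  apply: leq_ltn_trans ltn_pred.
  by rewrite -[X in _ <= X]mul1n leq_mul2r d_le1 orbT.
(* From here [d > 1], so vertices of degree at least [d] are among those bounded by [leWm]. *)
have leUm i : #|[set u in A i | d <= clique_degree A u]| <= m.
  apply: leq_trans (leWm i); apply: subset_leq_card.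
  apply/subsetP => u; rewrite !inE => /andP[-> du].
  exact: leq_trans d_gt1 du.
have [d_lem|m_ltd] := leqP d m.
  apply: leq_ltn_trans (card_neighbours_le (leqnn d) leUm) _.
  have m_gt0 : 0 < m := leq_trans d_gt0 d_lem.
  apply: leq_trans mm; apply: (@leq_ltn_trans (m * m.-1)).
    by rewrite leq_mul2r d_lem orbT.
  by rewrite ltn_pmul2l // prednK.
pose U := [set u | d <= clique_degree A u].
apply: (@leq_ltn_trans #|U|).
  by apply: subset_leq_card; apply/subsetP => u; rewrite !inE => /andP[].
(* After multiplying by [d]: [#|U| * d <= n * m < n * d]. *)
rewrite -(ltn_pmul2r d_gt0); apply: (@leq_ltn_trans (n * m)).
  apply: leq_trans (sum_clique_degree (U := U) (m := m) _); last first.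
    by move=> i; rewrite setIC; have := leUm i; rewrite setIdE.
  by rewrite -sum_nat_const; apply: leq_sum => u; rewrite inE.
by rewrite ltn_pmul2l.
Qed.

End UnionOfComplete.

Unset Implicit Arguments.

Theorem theorem1 (R : rcfType) (n : nat) (G : sgraph) (A : 'I_n -> {set G})
    (n_ge1 : 1 <= n)
    (G_union : union_of_complete A)
    (A_card : forall i : 'I_n, #|A i| = n)
    (A_meet : forall i j : 'I_n, i != j -> #|A i :&: A j| <= 1)
    (A_sqrt : forall i : 'I_n,
       (#|[set v in A i | (1 < clique_degree A v)%N]|%:R
          <= Num.sqrt (n%:R : R))%R) :
  colorable G n.
Proof.
pose w i := #|[set v in A i | 1 < clique_degree A v]|.
(* Taking [m] to be the attained maximum [w i0] lets [A_sqrt i0], squared in [R], give [m * m <= n]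
   without rounding a square root. *)
have [i0 wmax] : {i0 | \max_i w i = w i0} by by apply: bigop.eq_bigmax; rewrite card_ord.
apply: (greedy_colorable (f := clique_degree A)) => // v.
apply: (card_earlier_neighbours G_union (m := w i0)) => //.
  rewrite -(ler_nat R) natrM -expr2 -[leRHS]sqr_sqrtr ?ler0n //.
  by apply: lerXn2r (A_sqrt i0); rewrite nnegrE ?ler0n ?sqrtr_ge0.
by move=> i; rewrite -wmax; apply: bigop.leq_bigmax.
Qed.
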